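(* In the setting of the context with $k=1$ (so $\Psi\theta=\langle\theta,\psi\rangle_{\mathbb H}$ is real-valued), assume that the following holds for every $\alpha\in(0,1)$: whenever $C_N=\{x\in\mathbb R:(x-\hat\Psi_N)\hat\Sigma_N^{-1}(x-\hat\Psi_N)\le \rho_N\}$, where either $\rho_N=Q_{\chi^2_1}(1-\alpha)$ for all $N$, or $\rho_N$ is a statistic with $\Pi_N^\Psi(C_N\mid\mathcal D_N)=1-\alpha$ for all $N$, then $\mathbb P_{\theta_0}(\Psi\theta_0\in C_N)\to1-\alpha$, $$\mathrm{diam}(C_N)=(1+o_P(1))\sqrt{4\,Q_{\chi^2_1}(1-\alpha)\cdot\frac{i_D^{-1}}{N}},$$ and $\mathrm{diam}(C_N)\le C(1+o_P(1))/\sqrt{N\lambda_{\min}(\mathcal I_D)}$ for a constant $C>0$ independent of $N$. Let $\alpha\in(0,1)$ and, for all $N\in\mathbb N$, let $R_N$ be a statistic such that $I_N=[\hat\Psi_N-R_N,\hat\Psi_N+R_N]$ satisfies $\Pi_N^\Psi(I_N\mid\mathcal D_N)=1-\alpha$. Then $$\mathbb P_{\theta_0}(\Psi\theta_0\in I_N)\to1-\alpha,$$ and $$\mathrm{diam}(I_N)=(1+o_P(1))\sqrt{4\,Q_{\chi^2_1}(1-\alpha)\cdot\frac{i_D^{-1}}{N}},\qquad \mathrm{diam}(I_N)\le C'\,\frac{1+o_P(1)}{\sqrt{N\lambda_{\min}(\mathcal I_D)}}$$ for some constant $C'>0$ independent of $N$.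
   Context: Model. $\mathcal X\subset\mathbb R^d$ is a Borel set of positive finite Lebesgue measure with uniform distribution $\lambda_{\mathcal X}$; $\mathbb H$ is a Hilbert space with orthonormal basis $\{e_i\}_{i\in\mathbb N}$; $\Theta$ is a linear subspace of $\mathbb H$ containing $\mathrm{span}\{e_i\}_{i\in\mathbb N}$; $(V,\langle\cdot,\cdot\rangle_V)$ is a finite-dimensional inner product space; $L^2(\mathcal X;V)$ is the space of $V$-valued functions square integrable with respect to $\lambda_{\mathcal X}$; $\mathcal G:\Theta\to L^2(\mathcal X;V)$ is measurable, $\mathcal G_\theta:=\mathcal G(\theta)$. Observations $Y_i=\mathcal G_\theta(X_i)+\varepsilon_i$, with $X_i\sim\lambda_{\mathcal X}$, $\varepsilon_i$ centered Gaussian on $V$ with identity covariance operator, all $X_i,\varepsilon_i$ independent. Fix $\theta_0\in\Theta$; $\mathbb P_{\theta_0}$ is the law of the i.i.d. sequence $(X_i,Y_i)_{i\in\mathbb N}$ under $\theta=\theta_0$; $\mathcal D_N=((X_i,Y_i))_{i\le N}$; $o_P$ is with respect to $\mathbb P_{\theta_0}$. A statistic is a measurable function of $\mathcal D_N$. Fix a nonzero $\psi\in\mathbb H$ and let $\Psi\theta=\langle\theta,\psi\rangle_{\mathbb H}$. Prior and posterior. $E_D=\mathrm{span}\{e_1,\dots,e_D\}$ with $D=D(N)\to\infty$ as $N\to\infty$; $P_{E_D}:\mathbb H\to E_D$ is the orthogonal projection. $\langle\cdot,\cdot\rangle_{\mathcal H_N}$ is an inner product on $E_D$ and the prior $\Pi_N$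 is the centered Gaussian measure on $(E_D,\langle\cdot,\cdot\rangle_{\mathcal H_N})$ with identity covariance operator. With $\ell_N(\theta)=-\frac12\sum_{i=1}^N\|Y_i-\mathcal G_\theta(X_i)\|_V^2$, the posterior $\Pi_N(\cdot\mid\mathcal D_N)$ is the probability measure on $E_D$ with $\Pi_N$-density proportional to $e^{\ell_N}$. $\Pi_N^\Psi(\cdot\mid\mathcal D_N)$ is the law of $\Psi\theta_N$ for $\theta_N\sim\Pi_N(\cdot\mid\mathcal D_N)$, with mean $\hat\Psi_N$ and variance $\hat\Sigma_N$ (both exist). Convention: $\hat\Sigma_N^{-1}:=1$ if $\hat\Sigma_N=0$. $Q_{\chi^2_1}$ is the quantile function of the $\chi^2_1$ distribution; $\lambda_{\min}$ denotes the smallest eigenvalue. Linearization. Standing assumptions: there is a bounded linear operator $\mathbb I_{\theta_0}:\mathbb H\to L^2(\mathcal X;V)$ such that for every $h\in\Theta$, $\|\mathcal G(\theta_0+\epsilon h)-\mathcal G(\theta_0)-\epsilon\,\mathbb I_{\theta_0}[h]\|_{L^2}=o(\epsilon)$ as $\epsilon\to0$; and, with $\mathcal I=\mathbb I_{\theta_0}^*\mathbb I_{\theta_0}$, the operator $\mathcal I_D=P_{E_D}\mathcal I|_{E_D}:E_D\to E_D$ is invertible for all $D\in\mathbb N$. $[\mathcal I_D]\in\mathbb R^{D\times D}$ is the matrix $[\mathcal I_D]_{ij}=\langle\mathcal I_De_i,e_j\rangle_{\mathbb H}$, $\mathcal J_D=(\langle\psi,e_j\rangle_{\mathbb H})_{j\le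 D}\in\mathbb R^{1\times D}$, and $i_D=\big(\mathcal J_D[\mathcal I_D]^{-1}\mathcal J_D^\top\big)^{-1}$, which is well defined and positive for $D$ large enough. *)

(* Defs.v *)
From HB Require Import structures.
From mathcomp Require Import all_boot all_order all_algebra.
From mathcomp Require Import all_classical all_reals all_analysis.

Set Implicit Arguments.
Unset Strict Implicit.
Unset Printing Implicit Defensive.
Import Order.TTheory GRing.Theory Num.Theory numFieldNormedType.Exports.

Local Open Scope classical_set_scope.
Local Open Scope ring_scope.

Notation borel U := (g_sigma_algebraType (@open U)).

(* N observations (x_i, y_i) with x_i in R^d and y_i in V *)
Notation sample R d V N := (N.-tuple (d.-tuple R * borel V)%type).

Section lebesgue_Rd.
Context {R : realType}.

(* Lebesgue measure on R^d, as an iterated product of Lebesgue measures on R;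
   R^0 is one point of mass 1. *)
Fixpoint lebesgue_Rd (d : nat) : set (d.-tuple R) -> \bar R :=
  match d with
  | 0%N => dirac [tuple]
  | d'.+1 => pushforward
      (product_measure1 (@lebesgue_measure R) (@lebesgue_Rd d'))
      (fun p : R * d'.-tuple R => [tuple of p.1 :: p.2])
  end.

Definition uniform_Rd (d : nat) (X : set (d.-tuple R)) :
    set (d.-tuple R) -> \bar R :=
  fun A => (lebesgue_Rd (A `&` X) * ((fine (lebesgue_Rd X))^-1)%:E)%E.

End lebesgue_Rd.

Section hilbert.
Context {R : realType}.

Definition linear_subspace (U : lmodType R) (E : set U) : Prop :=
  E 0 /\ forall (a : R) u v, E u -> E v -> E (a *: u + v).

(* Inner products on a subspace; the values of ip outside E are irrelevant. *)
Definition inner_product_on (U : lmodType R) (E : set U) (ip : U -> U -> R) :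
    Prop :=
  [/\ forall u v, E u -> E v -> ip u v = ip v u,
      forall (a : R) u v w, E u -> E v -> E w ->
        ip (a *: u + v) w = a * ip u w + ip v w
    & forall u, E u -> u != 0 -> 0 < ip u u].

Definition finite_dimensional (U : lmodType R) : Prop :=
  exists (m : nat) (b : 'I_m -> U),
    forall u, exists c : 'I_m -> R, u = \sum_i c i *: b i.

(* The basis is indexed from 0, so span_first e D is the span of its first D
   members. *)
Definition span_first (U : lmodType R) (e : nat -> U) (D : nat) : set U :=
  [set u | exists c : 'I_D -> R, u = \sum_(i < D) c i *: e i].

Definition orthonormal_basis (H : normedModType R) (ip : H -> H -> R)
    (e : nat -> H) : Prop :=
  (forall i j, ip (e i) (e j) = (i == j)%:R) /\
  closure (\bigcup_D span_first e D) = [set: H].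

(* Orthogonal projection onto span_first e D, for orthonormal e. *)
Definition proj_first (U : lmodType R) (ip : U -> U -> R) (e : nat -> U)
    (D : nat) (u : U) : U :=
  \sum_(i < D) ip u (e i) *: e i.

End hilbert.

(* Measurability for the trace sigma-algebra on A, which need not be measurable
   itself (measurable_fun A f holds vacuously when A is not measurable). *)
Definition trace_measurable d1 d2 (T1 : measurableType d1)
    (T2 : measurableType d2) (A : set T1) (f : T1 -> T2) : Prop :=
  forall B, measurable B ->
    exists2 C, measurable C & A `&` f @^-1` B = A `&` C.

(* Elements of L^2(mu; V) are represented by measurable functions T -> V; two
   representatives define the same element when they agree mu-a.e. *)
Section L2.
Context {dT} {T : measurableType dT} {R : realType} {V : normedModType R}.
Variable mu : set T -> \bar R.
Implicit Types f g : T -> V.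

Definition in_L2 f : Prop :=
  measurable_fun [set: T] (f : T -> borel V) /\
  (\int[mu]_x (`|f x| ^+ 2)%:E < +oo)%E.

Definition L2norm f : R := Num.sqrt (fine (\int[mu]_x (`|f x| ^+ 2)%:E)%E).

Definition L2dot (ip : V -> V -> R) f g : R :=
  fine (\int[mu]_x (ip (f x) (g x))%:E)%E.

Context {H : normedModType R}.

(* Borel measurability of a map Theta -> L^2(mu; V): L^2(mu; V) is separable in
   the uses below, so its open balls generate the Borel sigma-algebra. *)
Definition L2_measurable (Theta : set H) (G : H -> T -> V) : Prop :=
  forall f (r : R), in_L2 f ->
    exists2 B : set (borel H), measurable B &
      Theta `&` [set h | L2norm (fun x => G h x - f x) < r] = Theta `&` B.

Definition bounded_linear_L2 (A : H -> T -> V) : Prop :=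
  [/\ forall h, in_L2 (A h),
      forall (a : R) h k,
        {ae mu, forall x, A (a *: h + k) x = a *: A h x + A k x}
    & exists C : R, forall h, L2norm (A h) <= C * `|h|].

(* The Riesz representative of h |-> <f, A h>, which is unique when it
   exists; it exists for bounded linear A on a complete H. *)
Definition L2_adjoint (ipH : H -> H -> R) (ipV : V -> V -> R)
    (A : H -> T -> V) f : H :=
  xget 0 [set g | forall h, ipH g h = L2dot ipV f (A h)].

End L2.

Section probability_notions.
Context {R : realType}.

(* Centered Gaussian measure with identity covariance on the finite-dimensional
   inner product space (E, ip): the linear form ip u has law N(0, ip u u) for
   every u in E.  The case u = 0 is left out since normal_prob is not the Dirac
   mass for standard deviation 0. *)
Definition standard_gaussian_on (U : lmodType R) (E : set U)
    (ip : U -> U -> R) (mu : set U -> \bar R) : Prop :=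
  mu E = 1%E /\
  forall u, E u -> u != 0 -> forall A : set R, measurable A ->
    mu (E `&` [set v | A (ip u v)]) =
    normal_prob 0 (Num.sqrt (ip u u)) A.

Definition chi2_1 : set R -> \bar R :=
  pushforward (normal_prob (0 : R) 1) (fun x : R => x ^+ 2).

Definition quantile (mu : set R -> \bar R) (p : R) : R :=
  inf [set x : R | (p%:E <= mu `]-oo, x]%classic)%E].

Definition mean (mu : set R -> \bar R) : R := fine (\int[mu]_x x%:E)%E.

Definition var (mu : set R -> \bar R) : R :=
  fine (\int[mu]_x ((x - mean mu) ^+ 2)%:E)%E.

Definition diam (A : set R) : R := sup [set `|x - y| | x in A & y in A].

Context {dO} {Omega : measurableType dO} (P : probability Omega R).

Definition mutually_independent (I : choiceType)
    (F : I -> set (set Omega)) : Prop :=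
  forall (s : seq I) (A : I -> set Omega), uniq s ->
    (forall i, i \in s -> F i (A i)) ->
    P (\big[setI/setT]_(i <- s) A i) = (\prod_(i <- s) P (A i))%E.

Definition generated_by dT (T : measurableType dT) (f : Omega -> T) :
    set (set Omega) :=
  preimage_set_system setT f measurable.

Definition is_oP1 (r : nat -> {RV P >-> R}) : Prop :=
  forall delta : R, 0 < delta ->
    P [set w | delta < `|r N w|] @[N --> \oo] --> 0%E.

End probability_notions.

Section bayes.
Context {R : realType} {d : nat} {V H : normedModType R}.

Definition loglik (G : H -> d.-tuple R -> V) (N : nat) (z : sample R d V N)
    (h : H) : R :=
  - (2^-1) * \sum_(i < N) `|((tnth z i).2 : V) - G h (tnth z i).1| ^+ 2.

(* The posterior for a prior Pi on the subspace E of H, seen as a measure on H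
   carried by E. *)
Definition posterior (G : H -> d.-tuple R -> V) (E : set H)
    (Pi : set (borel H) -> \bar R) (N : nat) (z : sample R d V N) :
    set (borel H) -> \bar R :=
  fun A =>
    (\int[Pi]_(h in A `&` E) (expR (loglik G z h))%:E *
     ((fine (\int[Pi]_(h in E) (expR (loglik G z h))%:E))^-1)%:E)%E.

Definition posterior_law (ipH : H -> H -> R) (psi : H)
    (G : H -> d.-tuple R -> V) (E : set H) (Pi : set (borel H) -> \bar R)
    (N : nat) (z : sample R d V N) : set R -> \bar R :=
  pushforward (posterior G E Pi z) (fun h : borel H => ipH h psi).

Definition var_inv (mu : set R -> \bar R) : R :=
  if var mu == 0 then 1 else (var mu)^-1.

(* C_N, for a given marginal posterior mu and radius rho *)
Definition credible_ellipsoid (mu : set R -> \bar R) (rho : R) : set R :=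
  [set x | (x - mean mu) * var_inv mu * (x - mean mu) <= rho].

(* I_N, for a given marginal posterior mu and half-length r *)
Definition credible_interval (mu : set R -> \bar R) (r : R) : set R :=
  `[mean mu - r, mean mu + r]%classic.

Context {dO} {Omega : measurableType dO} (P : probability Omega R).

Definition observations (G0 : d.-tuple R -> V)
    (X : nat -> {RV P >-> d.-tuple R}) (eps : nat -> {RV P >-> borel V})
    (N : nat) (w : Omega) : sample R d V N :=
  [tuple (X i w, (G0 (X i w) + (eps i w : V) : borel V)) | i < N].

Definition regression_noise_design (ipV : V -> V -> R)
    (calX : set (d.-tuple R))
    (X : nat -> {RV P >-> d.-tuple R}) (eps : nat -> {RV P >-> borel V}) :
    Prop :=
  [/\ forall i A, measurable A -> P (X i @^-1` A) = uniform_Rd calX A,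
      forall i, standard_gaussian_on [set: V] ipV (pushforward P (eps i))
    & mutually_independent P (fun ki : bool * nat =>
        if ki.1 then generated_by (X ki.2) else generated_by (eps ki.2))].

End bayes.

Section information.
Context {R : realType} {H : lmodType R}.
Variables (ip : H -> H -> R) (e : nat -> H) (info : H -> H) (psi : H).

Definition info_first (D : nat) : H -> H := fun h => proj_first ip e D (info h).

Definition info_mx (D : nat) : 'M[R]_D :=
  \matrix_(i, j) ip (info_first D (e i)) (e j).

Definition functional_row (D : nat) : 'rV[R]_D := \row_j ip psi (e j).

Definition efficient_info (D : nat) : R :=
  ((functional_row D *m invmx (info_mx D) *m (functional_row D)^T) 0 0)^-1.

(* The smallest eigenvalue of the operator I_D on E_D. *)
Definition lambda_min (D : nat) : R :=
  inf [set a : R | exists h, [/\ span_first e D h, h != 0 &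
                                 info_first D h = a *: h]].

End information.

(* Coverage and size of the random sets S N at level 1 - alpha, for the true
   value psi0, with iD N = i_{D(N)} and lam N = lambda_min(I_{D(N)}).
   Statements with 1 + o_P(1) are asymptotic: they hold for N large, and as
   equalities or inequalities of random variables, i.e. P-almost surely. *)
Definition asymptotically_valid {R : realType} {dO}
    {Omega : measurableType dO} (P : probability Omega R)
    (psi0 : R) (iD lam : nat -> R) (alpha : R) (S : nat -> Omega -> set R) :
    Prop :=
  [/\ P [set w | S N w psi0] @[N --> \oo] --> (1 - alpha)%:E,
      exists2 r : nat -> {RV P >-> R}, is_oP1 r &
        \forall N \near \oo, {ae P, forall w,
          diam (S N w) = (1 + r N w) *
            Num.sqrt (4 * quantile chi2_1 (1 - alpha) * ((iD N)^-1 / N%:R))}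
    & exists2 C : R, 0 < C &
        exists2 r : nat -> {RV P >-> R}, is_oP1 r &
          \forall N \near \oo, {ae P, forall w,
            diam (S N w) <= C * ((1 + r N w) / Num.sqrt (N%:R * lam N))}].

(* Main.v *)
Require Import Defs.
From HB Require Import structures.
From mathcomp Require Import all_boot all_order all_algebra.
From mathcomp Require Import all_classical all_reals all_analysis.
From mathcomp Require Import measurable_realfun.
From mathcomp Require Import ring lra.

Set Implicit Arguments.
Unset Strict Implicit.
Unset Printing Implicit Defensive.
Import Order.TTheory GRing.Theory Num.Theory numFieldNormedType.Exports.

Local Open Scope classical_set_scope.
Local Open Scope ring_scope.

(** For k = 1 the interval I_N is one of the ellipsoids C_N of the hypothesis.
    When the half-length R_N is nonnegative, I_N is the set of x with
    (x - mean)^2 <= R_N^2, and multiplying by the positive weight v_N (the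
    inverse posterior variance, or 1 when that variance vanishes) gives the
    ellipsoid of radius rho_N = R_N^2 v_N.  When R_N is negative I_N is empty,
    and so is the ellipsoid of radius -1.  With rho_N chosen in this way C_N and
    I_N are equal for every data set ([credible_ellipsoid_radius]), so rho_N is
    calibrated because R_N is, and the three conclusions for C_N are those for
    I_N.

    The mathematical content is that rho_N is a statistic, that is, that the
    posterior variance is a measurable function of the data.  The posterior has
    the likelihood as unnormalised density with respect to the prior.  The
    likelihood is jointly measurable in the data and the parameter
    ([measurable_loglik]): G is jointly measurable on Theta and E_D is a Borel
    subset of Theta ([measurable_span_first]), while the distance of the
    finite-dimensional, hence separable, space V is measurable for the product
    of the Borel sigma-algebras ([measurable_fun_dist]).  By Tonelli's theorem
    the integral of the likelihood over any Borel set of parameters is then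
    measurable in the data, so the marginal posterior is a finite kernel from
    data sets to the real line ([posterior_kernel]), and the mean and the
    variance of a finite kernel are measurable ([measurable_mean],
    [measurable_var]). *)

(** * Measurability of inversion and of distances *)

Lemma measurable_inv (R : realType) : measurable_fun [set: R] (@GRing.inv R).
Proof.
have m0 : measurable (~` [set 0 : R]) by exact: measurableC.
rewrite -(setUv [set 0 : R]); apply/measurable_funU => //; split.
  exact: measurable_fun_set1.
apply: open_continuous_measurable_fun.
  by rewrite openC; exact: closed_eq.
by move=> x; rewrite inE/= => /eqP x0; exact: inv_continuous.
Qed.


Section borel_normed.
Context {R : realType}.

Lemma continuous_borel_measurable (U : normedModType R) (f : borel U -> R) :
  continuous (f : U -> R) -> measurable_fun [set: borel U] f.
Proof.
move=> /continuousP cf.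
apply: (measurability _ (RGenOpens.measurableE R)).
move=> _ [_ [a [b ->] <-]]; rewrite setTI; apply: sub_sigma_algebra.
exact/cf/interval_open.
Qed.

Lemma measurable_borel_ball (V : normedModType R) (x : V) (r : R) :
  measurable (ball x r : set (borel V)).
Proof. by apply: sub_sigma_algebra; exact: ball_open. Qed.

(** The product of the Borel sigma-algebras of V may be smaller than the Borel
    sigma-algebra of V * V, so continuity of the distance is not enough.
    With a countable dense family q, however, |u - v| < r holds exactly when,
    for some i and some rational s, u is s-close and v is (r - s)-close to q i;
    this makes the sublevel sets countable unions of rectangles. *)
Lemma measurable_fun_dist (V : normedModType R) (I : countType) (q : I -> V) :
    (forall u (r : R), 0 < r -> exists i, `|u - q i| < r) ->
  measurable_fun [set: borel V * borel V] (fun p => `|(p.1 : V) - (p.2 : V)|).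
Proof.
move=> qdense; apply: (measurability _ (RGenInftyO.measurableE R)).
move=> _ [_ [r ->] <-]; rewrite setTI.
rewrite (_ : _ @^-1` _ = \bigcup_i \bigcup_(s : rat)
    ((ball (q i) (ratr s) : set (borel V)) `*`
     (ball (q i) (r - ratr s) : set (borel V)))).
  apply: countable_bigcupT_measurable => // i.
  apply: bigcupT_measurable_rat => s.
  by apply: measurableX; exact: measurable_borel_ball.
apply/seteqP; split=> [[u v]/=|[u v]/= [i _ [s _ []]]].
  rewrite in_itv/= => uvr.
  (* half the slack pays for the step from u to q i, the other half for s *)
  have [i uqi] := qdense u ((r - `|u - v|) / 2) ltac:(by rewrite divr_gt0// subr_gt0).
  have [s /[!in_itv]/= /andP[us sr]] := rat_in_itvoo uqi.
  exists i => //; exists s => //; rewrite -!ball_normE/=; split.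
    by rewrite distrC.
  have := ler_distD u (q i) v; rewrite (distrC (q i) u).
  by lra.
rewrite -!ball_normE/= in_itv/= => qu qv.
have := ler_distD (q i) u v; rewrite (distrC u (q i)).
by move: qu qv; lra.
Qed.

End borel_normed.

(** Rational combinations of a finite spanning family: each coefficient is
    approximated to within r / B, where B exceeds the sum of the norms of the
    spanning vectors. *)
Lemma finite_dimensional_dense (R : realType) (V : normedModType R) :
  finite_dimensional V -> exists (m : nat) (b : 'I_m -> V),
    forall u (r : R), 0 < r ->
      exists c : {ffun 'I_m -> rat}, `|u - \sum_i ratr (c i) *: b i| < r.
Proof.
move=> [m [b bspan]]; exists m, b => u r r0; have [c ->] := bspan u.
pose B := 1 + \sum_i `|b i|.
have B0 : 0 < B by rewrite ltr_pwDl// sumr_ge0.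
have approx (x : R) : exists s : rat, `|x - ratr s| < r / B.
  have /rat_in_itvoo[s] : x < x + r / B by rewrite ltrDl divr_gt0.
  rewrite in_itv/= => /andP[xs sx]; exists s.
  by rewrite ltr_norml; apply/andP; split; move: xs sx; lra.
have [s sc] := choice (fun i => approx (c i)).
exists [ffun i => s i]; rewrite -sumrB.
under eq_bigr do rewrite ffunE -scalerBl.
rewrite (le_lt_trans (ler_norm_sum _ _ _))//.
rewrite (@le_lt_trans _ _ (\sum_i (r / B) * `|b i|))//.
  by apply: ler_sum => i _; rewrite normrZ ler_wpM2r// ltW.
rewrite -mulr_sumr -mulrA gtr_pMr// mulrC ltr_pdivrMr// mul1r.
by rewrite ltrDr.
Qed.

(** * Inner products and finite-dimensional subspaces *)

Section inner_product_space.
Context {R : realType} {H : normedModType R} (ip : {dot H for idfun}).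
Hypothesis ip_norm : forall h, ip h h = `|h| ^+ 2.

Lemma dot_sym u v : ip u v = ip v u.
Proof. by rewrite hermC/= expr0 mul1r. Qed.

Lemma sqr_normD u v : `|u + v| ^+ 2 = `|u| ^+ 2 + 2 * ip u v + `|v| ^+ 2.
Proof.
by rewrite -!ip_norm linearDl !linearDr/= (dot_sym v u); ring.
Qed.

(** Polarization reduces this to the continuity of the norm. *)
Lemma measurable_dotl v : measurable_fun [set: borel H] (fun u => ip u v).
Proof.
rewrite (_ : (fun _ => _) =
    fun u => 2^-1 * (`|u + v| ^+ 2 - `|u| ^+ 2 - `|v| ^+ 2)); last first.
  by apply/funext => u; rewrite sqr_normD; field.
apply: measurable_funM => //; apply: measurable_funB => //.
apply: measurable_funB; apply: measurable_funX;
  apply: continuous_borel_measurable; last exact: norm_continuous.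
move=> u; apply: cvg_norm; apply: cvgD; first exact: cvg_id.
exact: cvg_cst.
Qed.

Variables (e : nat -> H) (ortho : forall i j, ip (e i) (e j) = (i == j)%:R).

Lemma dot_sum_orthonormal n (c : 'I_n -> R) u :
  ip u (\sum_(i < n) c i *: e i) = \sum_(i < n) c i * ip u (e i).
Proof. by rewrite linear_sumr; apply: eq_bigr => i _; rewrite linearZr_LR. Qed.

Lemma coord_orthonormal n (c : 'I_n -> R) (j : 'I_n) :
  ip (\sum_(i < n) c i *: e i) (e j) = c j.
Proof.
rewrite dot_sym dot_sum_orthonormal (bigD1 j)//= ortho eqxx mulr1.
rewrite big1 ?addr0// => i ij; rewrite ortho.
by rewrite (_ : (j == i :> nat) = false) ?mulr0//; apply/negbTE; rewrite eq_sym.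
Qed.

(** Equality in Bessel's inequality characterizes the span; this form of the
    subspace involves only measurable functions of h. *)
Lemma span_firstP n :
  span_first e n = [set h | `|h| ^+ 2 = \sum_(i < n) ip h (e i) ^+ 2].
Proof.
apply/seteqP; split=> h /=.
  move=> [c ->]; rewrite -ip_norm dot_sum_orthonormal.
  by apply: eq_bigr => i _; rewrite coord_orthonormal expr2.
(* the squared distance from h to its projection p is |h|^2 - |p|^2 = 0 *)
move=> hE; exists (fun i => ip h (e i)); apply/eqP; rewrite -subr_eq0 -normr_eq0.
set p := \sum_(i < n) _.
have hp : ip h p = `|h| ^+ 2.
  by rewrite hE dot_sum_orthonormal; apply: eq_bigr => i _; rewrite expr2.
have pp : `|p| ^+ 2 = `|h| ^+ 2.
  rewrite hE -ip_norm dot_sum_orthonormal; apply: eq_bigr => i _.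
  by rewrite coord_orthonormal expr2.
by rewrite -sqrf_eq0 sqr_normD normrN linearNr/= hp pp; apply/eqP; ring.
Qed.

Lemma measurable_span_first n : measurable (span_first e n : set (borel H)).
Proof.
rewrite span_firstP -[X in measurable X]setTI.
pose g (h : borel H) := `|h : H| ^+ 2 - \sum_(i < n) ip h (e i) ^+ 2.
rewrite (_ : [set h | _] = g @^-1` [set 0]); last first.
  apply/seteqP; split=> h; rewrite /g/=; first by move=> ->; rewrite subrr.
  by move/eqP; rewrite subr_eq0 => /eqP.
suff mg : measurable_fun setT g by exact: mg.
apply: measurable_funB.
  apply: measurable_funX; apply: continuous_borel_measurable.
  exact: norm_continuous.
apply: measurable_sum => i; apply: measurable_funX.
exact: measurable_dotl.
Qed.

End inner_product_space.

(** * Mean and variance of a finite kernel *)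

Section kernel_moments.
Context {R : realType} d (Z : measurableType d).
Variable k : Z -> {measure set R -> \bar R}.
Hypothesis mk : forall U, measurable U -> measurable_fun [set: Z] (k ^~ U).

Lemma measurable_mean : measurable_fun [set: Z] (fun z => mean (k z)).
Proof.
apply: (measurableT_comp (fine_measurable measurableT)).
under eq_fun do rewrite integralE.
by apply: emeasurable_funB; apply: measurable_fun_integral_kernel => //;
  [apply: measurable_funepos|apply: measurable_funeneg]; exact/measurable_EFinP.
Qed.

HB.instance Definition _ := isKernel.Build _ _ Z R R k mk.
Hypothesis ku : measure_fam_uub k.
HB.instance Definition _ := Kernel_isFinite.Build _ _ Z R R k ku.

(** The centering point mean (k z) moves with z, so the integrand is a function
    of both z and x: this is where a uniform bound on the total mass of the
    kernel is used. *)
Lemma measurable_var : measurable_fun [set: Z] (fun z => var (k z)).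
Proof.
apply: (measurableT_comp (fine_measurable measurableT)).
apply: (measurable_fun_integral_finite_kernel
  (fun p : Z * R => ((p.2 - mean (k p.1)) ^+ 2)%:E) k) => [p|].
  by rewrite lee_fin sqr_ge0.
apply/measurable_EFinP; apply: measurable_funX; apply: measurable_funB => //.
exact: (measurableT_comp measurable_mean).
Qed.

Lemma measurable_var_inv : measurable_fun [set: Z] (fun z => var_inv (k z)).
Proof.
apply: measurable_fun_ifT => //.
  by apply: measurable_fun_eqr => //; exact: measurable_var.
exact: (measurableT_comp (@measurable_inv R) measurable_var).
Qed.

End kernel_moments.

(** The convention at variance 0 also covers an infinite second moment, whose
    real value is 0. *)
Lemma var_inv_gt0 (R : realType) (mu : {measure set R -> \bar R}) :
  0 < var_inv mu.
Proof.
rewrite /var_inv; case: eqVneq => // var_neq0; rewrite invr_gt0 lt0r var_neq0.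
by apply: fine_ge0; apply: integral_ge0 => x _; rewrite lee_fin sqr_ge0.
Qed.

(** * Intervals as ellipsoids *)

(** The value -1 stands for a negative half-length: it makes the ellipsoid
    empty, like the interval. *)
Definition ellipsoid_radius (R : realType) (mu : set R -> \bar R) (r : R) : R :=
  if r < 0 then -1 else r ^+ 2 * var_inv mu.

(** This is an identity of sets for every half-length, so no exceptional event
    on which the half-length is negative has to be discarded. *)
Lemma credible_ellipsoid_radius (R : realType) (mu : set R -> \bar R) (r : R) :
  0 < var_inv mu ->
  credible_ellipsoid mu (ellipsoid_radius mu r) = credible_interval mu r.
Proof.
move=> v0; rewrite /credible_ellipsoid /credible_interval
  /ellipsoid_radius.
move: (mean mu) => m; apply/seteqP.
suff E x : ((x - m) * var_inv mu * (x - m) <=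
    if r < 0 then -1 else r ^+ 2 * var_inv mu) = (x \in `[m - r, m + r]).
  by split=> x /=; rewrite E.
rewrite in_itv/= mulrAC -expr2; case: ltrP => [r0|r0].
  rewrite leNgt (lt_le_trans _ (mulr_ge0 (sqr_ge0 _) (ltW v0)))//.
  by apply/esym/negbTE/negP => /andP[]; lra.
by rewrite ler_pM2r// -[X in X <= _]real_normK ?num_real// ler_sqr ?nnegrE// ler_distl.
Qed.

(** * The posterior as a kernel *)

Section measure_with_density.
Context {R : realType} d (T : measurableType d) (mu : {measure set T -> \bar R}).
Variables (E : set T) (f : T -> \bar R) (c : R).
Hypotheses (mE : measurable E) (mf : measurable_fun E f).
Hypotheses (f0 : forall x, E x -> (0 <= f x)%E) (c0 : 0 <= c).

Let nu (A : set T) : \bar R := (\int[mu]_(x in A `&` E) f x * c%:E)%E.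

Let nu0 : nu set0 = 0%E.
Proof. by rewrite /nu set0I integral_set0 mul0e. Qed.

Let nu_ge0 A : (0 <= nu A)%E.
Proof. by rewrite mule_ge0// integral_ge0// => x [_ /f0]. Qed.

Let nu_sigma : semi_sigma_additive nu.
Proof.
move=> F mF tF mUF; rewrite [X in _ --> X](_ : _ = (\sum_(i <oo) nu (F i))%E).
  by apply: is_cvg_nneseries => i _ _; exact: nu_ge0.
rewrite /nu setI_bigcupl ge0_integral_bigcup.
- rewrite muleC -nneseriesZl; last by move=> i _; apply: integral_ge0 => x [_ /f0].
  by apply: eq_eseriesr => i _; rewrite muleC.
- by move=> i; exact: measurableI.
- apply: measurable_funS mf => //; rewrite -setI_bigcupl; exact: subIsetr.
- by move=> x [i _ [_ /f0]].
- exact: trivIset_setIr.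
Qed.

Lemma measure_with_density :
  exists m : {measure set T -> \bar R}, m = nu :> (set T -> \bar R).
Proof.
pose m : {measure set T -> \bar R} :=
  HB.pack_for {measure set T -> \bar R} nu
    (isMeasure.Build _ _ _ nu nu0 nu_ge0 nu_sigma).
by exists m.
Qed.

End measure_with_density.

Section posterior_measurability.
Context {R : realType} (d : nat) (V H : normedModType R).
Variables (G : H -> d.-tuple R -> V) (E : set (borel H)).
Hypotheses (V_fin : finite_dimensional V) (mE : measurable E).
Hypothesis mG : measurable_fun [set p : borel H * d.-tuple R | E p.1]
  (fun p : borel H * d.-tuple R => G p.1 p.2 : borel V).
Variable N : nat.

(** Outside E nothing is known about G, so G is cut off there: the cut-off is
    measurable everywhere and gives the same likelihood on E. *)
Lemma measurable_loglik : measurable_fun (setT `*` E)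
  (fun p : sample R d V N * borel H => loglik G p.1 p.2).
Proof.
have [m [b bdense]] := finite_dimensional_dense V_fin.
have mdist := measurable_fun_dist bdense.
apply: measurable_funM => //; apply: measurable_sum => i; apply: measurable_funX.
pose GE := (fun p : borel H * d.-tuple R => G p.1 p.2 : borel V)
  \_ [set p | E p.1].
have mGE : measurable_fun setT GE.
  apply: (measurable_restrictT _ _).1 => //.
  rewrite [X in measurable X](_ : _ = E `*` setT); first exact: measurableX.
  by apply/seteqP; split=> [p|p []].
have mtnth : measurable_fun setT (fun p : sample R d V N * borel H => tnth p.1 i).
  exact: (measurableT_comp (measurable_tnth i) measurable_fst).
apply: (eq_measurable_fun (fun p : sample R d V N * borel H =>
    `|((tnth p.1 i).2 : V) - (GE (p.2, (tnth p.1 i).1) : V)|)).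
  by move=> [z h]; rewrite inE => -[_ Eh]; rewrite /GE patchE mem_set.
apply: measurable_funTS.
apply: (measurableT_comp (g := fun p : sample R d V N * borel H =>
    ((tnth p.1 i).2, GE (p.2, (tnth p.1 i).1))) mdist).
apply: measurable_fun_pair; first exact: (measurableT_comp measurable_snd mtnth).
apply: (measurableT_comp mGE); apply: measurable_fun_pair => //.
exact: (measurableT_comp measurable_fst mtnth).
Qed.

Let lik (z : sample R d V N) (h : borel H) : \bar R := (expR (loglik G z h))%:E.

Let lik_ge0 z h : (0 <= lik z h)%E.
Proof. by rewrite lee_fin expR_ge0. Qed.

Let lik_le1 z h : (lik z h <= 1)%E.
Proof.
rewrite lee_fin -expR0 ler_expR /loglik mulNr oppr_le0 mulr_ge0//.
by apply: sumr_ge0 => i _; rewrite sqr_ge0.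
Qed.

Let mlik : measurable_fun (setT `*` E)
  (fun p : sample R d V N * borel H => lik p.1 p.2).
Proof. by apply/measurable_EFinP; apply: measurableT_comp measurable_loglik. Qed.

Let mlikr z : measurable_fun E (lik z).
Proof.
apply: (measurable_comp (F := setT `*` E) (g := pair z) _ _ mlik).
- exact: measurableX.
- by move=> _ [h Eh <-].
- exact: measurable_funTS.
Qed.

Variable Pi : probability (borel H) R.

Let mint A : measurable A -> measurable_fun [set: sample R d V N]
  (fun z => \int[Pi]_(h in A `&` E) lik z h)%E.
Proof.
move=> mA; have mAE : measurable ([set: sample R d V N] `*` (A `&` E)).
  by apply: measurableX => //; exact: measurableI.
pose F := (fun p : sample R d V N * borel H => lik p.1 p.2) \_ (setT `*` (A `&` E)).
rewrite (_ : (fun _ => _) = fubini_F Pi F).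
  apply: measurable_fun_fubini_tonelli_F.
    apply: (measurable_restrictT _ _).1 => //; apply: measurable_funS mlik => //.
      exact: measurableX.
    by move=> [z h] [_ [_ Eh]].
  by move=> p; rewrite /F patchE; case: ifP.
apply/funext => z; rewrite integral_mkcond; apply: eq_integral => h _.
by rewrite /F !patchE in_setX/= in_setT.
Qed.

Variables (phi : borel H -> R) (mphi : measurable_fun [set: borel H] phi).

(** The likelihood is at most 1, so the evidence is finite and the posterior has
    total mass at most 1. *)
Lemma posterior_kernel :
  exists k : sample R d V N -> {measure set R -> \bar R},
    [/\ forall z, pushforward (posterior G E Pi z) phi = k z,
        forall U, measurable U -> measurable_fun [set: sample R d V N] (k ^~ U)
      & measure_fam_uub k].
Proof.
pose ev z := (\int[Pi]_(h in E) lik z h)%E.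
have ev0 z : (0 <= ev z)%E by exact: integral_ge0.
have ev1 z : (ev z <= 1)%E.
  rewrite (@le_trans _ _ (\int[Pi]_(h in E) 1)%E)//; first exact: ge0_le_integral.
  by rewrite integral_cst// mul1e probability_le1.
have evfin z : ev z \is a fin_num.
  by rewrite ge0_fin_numE// (le_lt_trans (ev1 z))// ltry.
have c0 z : 0 <= (fine (ev z))^-1 by rewrite invr_ge0 fine_ge0.
have [nu nuE] := choice (fun z =>
  measure_with_density Pi mE (mlikr z) (fun h _ => lik_ge0 z h) (c0 z)).
have push z : exists m : {measure set R -> \bar R},
    m = pushforward (nu z) phi :> (set R -> \bar R).
  by unshelve refine (ex_intro _
    (pushforward (nu z) phi : {measure set R -> \bar R}) _).
have [k kE] := choice push.
have kEpost z : pushforward (posterior G E Pi z) phi = k z.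
  by rewrite kE /pushforward nuE.
exists k; split=> [//|U mU|].
  rewrite (_ : k ^~ U = fun z =>
      (\int[Pi]_(h in phi @^-1` U `&` E) lik z h * ((fine (ev z))^-1)%:E)%E).
    have mphiU : measurable (phi @^-1` U) by rewrite -[X in measurable X]setTI; exact: mphi.
    apply: emeasurable_funM; first exact: mint.
    apply/measurable_EFinP; apply: (measurableT_comp (@measurable_inv R)).
    apply: (measurableT_comp (fine_measurable measurableT)).
    rewrite /ev; under eq_fun do rewrite -[X in integral _ X]setTI.
    exact: mint.
  by apply/funext => z; rewrite kE /pushforward nuE.
(* the bound has to be strict, hence 2 for a total mass of at most 1 *)
exists 2 => z; rewrite kE /pushforward nuE preimage_setT setTI -/(ev z).
rewrite -[X in (X * _)%E](fineK (evfin z)) -EFinM lte_fin.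
have [->|ev_neq0] := eqVneq (fine (ev z)) 0; first by rewrite mul0r.
by rewrite divff// ltr1n.
Qed.

End posterior_measurability.

(** * The credible interval *)

Theorem corollary2p9
  (R : realType)
  (d : nat) (calX : set (d.-tuple R))
  (calX_borel : measurable calX)
  (calX_gt0 : (0 < lebesgue_Rd calX)%E) (calX_fin : (lebesgue_Rd calX < +oo)%E)
  (H : completeNormedModType R) (ipH : {dot H for idfun})
  (ipH_norm : forall h, ipH h h = `|h| ^+ 2)
  (e : nat -> H) (e_basis : orthonormal_basis ipH e)
  (Theta : set H) (Theta_sub : linear_subspace Theta)
  (Theta_e : forall D, span_first e D `<=` Theta)
  (V : normedModType R) (ipV : {dot V for idfun})
  (ipV_norm : forall v, ipV v v = `|v| ^+ 2)
  (V_fin : finite_dimensional V)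
  (G : H -> d.-tuple R -> V)
  (G_L2 : forall theta, Theta theta -> in_L2 (uniform_Rd calX) (G theta))
  (G_measurable : L2_measurable (uniform_Rd calX) Theta G)
  (* the representatives G theta of elements of L^2 are chosen jointly
     measurable in (theta, x), as the likelihood at a data point requires *)
  (G_joint : trace_measurable
     [set p : borel H * d.-tuple R | Theta p.1]
     (fun p : borel H * d.-tuple R => G p.1 p.2 : borel V))
  (theta0 : H) (theta0_in : Theta theta0)
  (psi : H) (psi_neq0 : psi != 0)
  (dO : measure_display) (Omega : measurableType dO) (P : probability Omega R)
  (X : nat -> {RV P >-> d.-tuple R}) (eps : nat -> {RV P >-> borel V})
  (model : regression_noise_design ipV calX X eps)
  (D : nat -> nat) (D_infty : D N @[N --> \oo] --> \oo)
  (ipN : nat -> H -> H -> R)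
  (ipN_inner : forall N, inner_product_on (span_first e (D N)) (ipN N))
  (Pi : nat -> probability (borel H) R)
  (Pi_gauss : forall N,
     standard_gaussian_on (span_first e (D N)) (ipN N) (Pi N))
  (II : H -> d.-tuple R -> V)
  (II_lin : bounded_linear_L2 (uniform_Rd calX) II)
  (II_deriv : forall h, Theta h ->
     L2norm (uniform_Rd calX)
       (fun x => G (theta0 + t *: h) x - G theta0 x - t *: II h x) / t
       @[t --> (0 : R)^'] --> (0 : R)) :
  let info := fun h => L2_adjoint (uniform_Rd calX) ipH ipV II (II h) in
  let data := observations (G theta0) X eps in
  let postPsi := fun N (z : sample R d V N) =>
    posterior_law ipH psi G (span_first e (D N)) (Pi N) z in
  let valid := asymptotically_valid P (ipH theta0 psi)
    (fun N => efficient_info ipH e info psi (D N))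
    (fun N => lambda_min ipH e info (D N)) in
  (forall D0, set_bij (span_first e D0) (span_first e D0)
                (info_first ipH e info D0)) ->
  (forall (alpha : R) (rho : forall N, sample R d V N -> R),
     0 < alpha < 1 ->
     let C := fun N w =>
       credible_ellipsoid (postPsi N (data N w)) (rho N (data N w)) in
     ((forall N z, rho N z = quantile chi2_1 (1 - alpha)) \/
      (forall N, (0 < N)%N ->
         measurable_fun [set: sample R d V N] (rho N) /\
         {ae P, forall w, postPsi N (data N w) (C N w) = (1 - alpha)%:E})) ->
     valid alpha C) ->
  forall (alpha : R) (Rad : forall N, sample R d V N -> R),
    0 < alpha < 1 ->
    let I := fun N w =>
      credible_interval (postPsi N (data N w)) (Rad N (data N w)) in
    (forall N, (0 < N)%N ->
       measurable_fun [set: sample R d V N] (Rad N) /\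
       {ae P, forall w, postPsi N (data N w) (I N w) = (1 - alpha)%:E}) ->
    valid alpha I.
Proof.
move=> info data postPsi valid _ validC alpha Rad alpha01 I Rad_level.
have [ortho _] := e_basis.
have mE N : measurable (span_first e (D N) : set (borel H)).
  exact (measurable_span_first ipH_norm ortho (D N)).
have mG N : measurable_fun
    [set p : borel H * d.-tuple R | span_first e (D N) p.1]
    (fun p : borel H * d.-tuple R => G p.1 p.2 : borel V).
  move=> mEN B mB; have [C mC GC] := G_joint B mB.
  rewrite [X in measurable X](_ : _ =
    [set p : borel H * d.-tuple R | span_first e (D N) p.1] `&` C).
    exact: measurableI.
  have sub : [set p : borel H * d.-tuple R | span_first e (D N) p.1] `<=`
      [set p | Theta p.1] by move=> p; exact: Theta_e.
  by rewrite -(setIidl sub) -!setIA GC.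
have kernelP N := posterior_kernel V_fin (mE N) (mG N) N (Pi N)
  (measurable_dotl ipH_norm psi).
pose rho N (z : sample R d V N) := ellipsoid_radius (postPsi N z) (Rad N z).
have CI N w :
    credible_ellipsoid (postPsi N (data N w)) (rho N (data N w)) = I N w.
  apply: credible_ellipsoid_radius.
  by have [k [kE _ _]] := kernelP N; rewrite [postPsi _ _]kE; exact: var_inv_gt0.
rewrite (_ : I = fun N w =>
    credible_ellipsoid (postPsi N (data N w)) (rho N (data N w))); last first.
  by apply/funext => N; apply/funext => w; rewrite CI.
apply: validC => //; right=> N N0.
have [mRad level] := Rad_level N N0; split; last first.
  by apply: filterS level => w; rewrite CI.
have [k [kE mk ku]] := kernelP N.
rewrite /rho /ellipsoid_radius.
rewrite (_ : @postPsi N = k); last by apply/funext => z; exact: kE.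
apply: measurable_fun_ifT => //; first exact: measurable_fun_ltr.
apply: measurable_funM; first exact: measurable_funX.
exact: measurable_var_inv.
Qed.
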